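(* Let $f:\mathbb{R}^n\to\mathbb{R}$ be convex and differentiable with $L$-Lipschitz continuous gradient, $L>0$, let $\rho>0$, let $F(x)=f(x)+\rho\|x\|_1$, and suppose that $F^*=\inf_{x\in\mathbb{R}^n}F(x)>-\infty$ and that $X^*=\{x\in\mathbb{R}^n:F(x)=F^*\}$ is nonempty. Let $h^*\in\mathbb{R}^n$ be the vector such that $\nabla f(x^* )=h^*$ for all $x^*\in X^*$, let $E=\{i:|h_i^*|=\rho\}$, and define $\phi:\mathbb{R}^{|E|}\to\mathbb{R}$ by $\phi(x_E)=-(h_E^* )^\top x_E+f((x_E,0))$. Suppose that $\phi$ is strongly convex and let $l_E>0$ be its strong convexity parameter. Let $\lambda\in(0,1/L]$, $0<\mu\le l_E$, and $$\lambda_k=\lambda,\qquad \alpha_k=\frac{1-\sqrt{\mu\lambda}}{1+\sqrt{\mu\lambda}}\qquad\forall k\in\mathbb{N}.$$ Let $x^0,x^1\in\mathbb{R}^n$ and, for all $k\in\mathbb{N}$, let $$y^{k+1}=x^k+\alpha_k(x^k-x^{k-1}),\qquad x^{k+1}=\operatorname{prox}_{\lambda_k\rho\|\cdot\|_1}\big(y^{k+1}-\lambda_k\nabla f(y^{k+1})\big).$$ Then $\{x^k\}$ converges R-linearly to the unique minimizer $x^*$ of $F$, and $F(x^k)$ converges R-linearly to $F^*$; specifically $$\|x^k-x^*\|^2=O\Big(\big(1-\sqrt{\mu\lambda}\big)^k\Big)\qquad\text{and}\qquad F(x^k)-F^*=O\Big(\big(1-\sqrt{\mu\lambda}\big)^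k\Big).$$
   Context: $\mathbb{N}=\{1,2,\dots\}$. $\operatorname{prox}_g(y)=\arg\min_{x}\{\tfrac12\|x-y\|^2+g(x)\}$. The strong convexity parameter of $\phi$ is the largest $m>0$ such that $\phi-\frac m2\|\cdot\|^2$ is convex. The elements of $E\subseteq\{1,\dots,n\}$ are listed in increasing order, $E(j)$ being the $j$th element; for $v\in\mathbb{R}^n$, $v_E\in\mathbb{R}^{|E|}$ has entries $v_{E(j)}$, and $(v_E,0)\in\mathbb{R}^n$ is the vector whose $i$th entry is $v_i$ if $i\in E$ and $0$ otherwise. Under the stated assumptions $\nabla f$ is constant on $X^*$, so $h^*$ is well defined, and $|h_i^*|\le\rho$ for every $i$. A sequence converges R-linearly with rate $q$ if its error (distance to the limit) is $O(q^k)$. *)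

(* Defs.v *)
From HB Require Import structures.
From mathcomp Require Import all_boot all_order all_algebra.
From mathcomp Require Import all_classical all_reals all_analysis.

Set Implicit Arguments.
Unset Strict Implicit.
Unset Printing Implicit Defensive.

Import Order.TTheory GRing.Theory Num.Theory.
Import numFieldNormedType.Exports.

Local Open Scope classical_set_scope.
Local Open Scope ring_scope.

Definition dotp (R : realType) n (u v : 'rV[R]_n) : R :=
  \sum_i u 0 i * v 0 i.

(* The library's norm `|u| on 'rV[R]_n is the sup norm, hence these two. *)
Definition norm2 (R : realType) n (u : 'rV[R]_n) : R :=
  Num.sqrt (\sum_i u 0 i ^+ 2).

Definition norm1 (R : realType) n (u : 'rV[R]_n) : R := \sum_i `|u 0 i|.

(* Vector of partial derivatives; it represents the differential only where
   f is differentiable. *)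
Definition gradient (R : realType) n (f : 'rV[R]_n -> R) (x : 'rV[R]_n) :
    'rV[R]_n :=
  \row_i 'D_(delta_mx 0 i) f x.

Definition lipschitz2 (R : realType) n (L : R) (g : 'rV[R]_n -> 'rV[R]_n) :=
  forall x y, norm2 (g x - g y) <= L * norm2 (x - y).

Definition argmin (R : realType) (T : Type) (F : T -> R) : set T :=
  [set x | forall z, F x <= F z].

(* The default value 0 is only taken when there is no minimizer. *)
Definition prox (R : realType) n (g : 'rV[R]_n -> R) (y : 'rV[R]_n) :
    'rV[R]_n :=
  xget 0 (argmin (fun x => 2^-1 * norm2 (x - y) ^+ 2 + g x)).

Definition modulus_convex (R : realType) n (m : R) (phi : 'rV[R]_n -> R) :=
  convex_function [set: 'rV[R]_n] (fun x => phi x - m / 2 * norm2 x ^+ 2).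

Definition strongly_convex (R : realType) n (phi : 'rV[R]_n -> R) :=
  exists2 m, 0 < m & modulus_convex m phi.

(* l is the largest m > 0 for which phi - (m / 2) |.|^2 is convex.  There is no
   such l for n = 0, where every m qualifies. *)
Definition strong_convexity_parameter (R : realType) n
    (phi : 'rV[R]_n -> R) (l : R) :=
  [/\ 0 < l, modulus_convex l phi &
      forall m, 0 < m -> modulus_convex m phi -> m <= l].

(* enum_val lists the elements of E : {set 'I_n} in increasing order, so
   enum_val j is the j-th element of E, counting from 0. *)
Definition restrict_set (R : realType) n (E : {set 'I_n}) (v : 'rV[R]_n) :
    'rV[R]_#|E| :=
  \row_j v 0 (enum_val j).

(* The vector (u, 0) of R^n: the sum has the single term u_j when i is the j-th
   element of E, and is empty when i is not in E. *)
Definition extend0 (R : realType) n (E : {set 'I_n}) (u : 'rV[R]_#|E|) :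
    'rV[R]_n :=
  \row_i \sum_(j < #|E| | enum_val j == i) u 0 j.

(* [err] is an error sequence (distance to the limit). *)
Definition linear_rate (R : realType) (q : R) (err : nat -> R) : Prop :=
  (err : nat -> R^o) =O_\oo (fun k => q ^+ k : R^o).

Definition R_linear_cvg (R : realType) (T : Type) (dist : T -> T -> R)
    (u : nat -> T) (l : T) : Prop :=
  exists q : R, 0 <= q < 1 /\ linear_rate q (fun k => dist (u k) l).

(* Main.v *)
(** Along the iteration lambda F(x^k) + |x^k - x^{k-1}|^2 / 2 decreases by a
    fixed multiple of |x^k - x^{k-1}|^2, so these increments tend to 0.  Strong
    convexity of phi bounds the sublevel sets of F, hence also F(x^k) tends to
    the minimum, and cocoercivity makes the gradient at y^k tend to h.  Off E
    one has |h_i| < rho, so soft thresholding eventually sends these coordinates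
    exactly to 0.  From then on the iteration is an accelerated proximal
    gradient method on vectors supported in E, where f is strongly convex.  With
    q = sqrt (mu lambda) and xs the minimizer, the quantity
      lambda (F(x^k) - F(xs)) + |q (x^k - xs) + (1 - q) (x^k - x^{k-1})|^2 / 2
    is then multiplied by at most 1 - q at each step. *)

Require Import Defs.
From HB Require Import structures.
From mathcomp Require Import all_boot all_order all_algebra.
From mathcomp Require Import all_classical all_reals all_analysis.
From mathcomp Require Import ring lra.

Import Order.TTheory GRing.Theory Num.Theory.
Import numFieldNormedType.Exports.

Local Open Scope classical_set_scope.
Local Open Scope ring_scope.

Set Implicit Arguments.
Unset Strict Implicit.
Unset Printing Implicit Defensive.

(** * Euclidean inner product on row vectors *)

Section InnerProduct.
Context {R : realType} {n : nat}.
Implicit Types (u v w : 'rV[R]_n) (c : R).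

Lemma dotpC u v : dotp u v = dotp v u.
Proof. by apply: eq_bigr => i _; rewrite mulrC. Qed.

Lemma dotpDl u v w : dotp (u + v) w = dotp u w + dotp v w.
Proof. by rewrite -big_split; apply: eq_bigr => i _; rewrite mxE mulrDl. Qed.

Lemma dotpZl c u v : dotp (c *: u) v = c * dotp u v.
Proof. by rewrite mulr_sumr; apply: eq_bigr => i _; rewrite mxE mulrA. Qed.

Lemma dotpNl u v : dotp (- u) v = - dotp u v.
Proof. by rewrite -scaleN1r dotpZl mulN1r. Qed.

Lemma dotpDr u v w : dotp u (v + w) = dotp u v + dotp u w.
Proof. by rewrite dotpC dotpDl !(dotpC _ u). Qed.

Lemma dotpZr c u v : dotp u (c *: v) = c * dotp u v.
Proof. by rewrite dotpC dotpZl dotpC. Qed.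

Lemma dotpNr u v : dotp u (- v) = - dotp u v.
Proof. by rewrite dotpC dotpNl dotpC. Qed.

Definition dotpE := (dotpDl, dotpDr, dotpNl, dotpNr, dotpZl, dotpZr).

Lemma dotpp_ge0 u : 0 <= dotp u u.
Proof. by apply: sumr_ge0 => i _; rewrite -expr2 sqr_ge0. Qed.

Lemma norm2_sqr u : norm2 u ^+ 2 = dotp u u.
Proof.
by rewrite sqr_sqrtr ?sumr_ge0// => i _; rewrite sqr_ge0.
Qed.

Lemma sqr_coord_le u i : u 0 i ^+ 2 <= dotp u u.
Proof.
rewrite /dotp (bigD1 i)//= -expr2 lerDl sumr_ge0// => j _.
by rewrite -expr2 sqr_ge0.
Qed.

Lemma normr_coord_le c u i : 0 <= c -> dotp u u <= c ^+ 2 -> `|u 0 i| <= c.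
Proof.
move=> c0 uc.
rewrite -(ger0_norm c0) -ler_sqr ?nnegrE// !real_normK ?num_real//.
exact: le_trans (sqr_coord_le _ _) uc.
Qed.

Lemma dotpp_le0 u : dotp u u <= 0 -> u = 0.
Proof.
move=> u0; apply/rowP => i; rewrite mxE; apply/eqP.
by rewrite -normr_le0; apply: normr_coord_le; rewrite // expr0n.
Qed.

(** Expand the nonnegative quantity [c * |u - v / c|^2]; the free weight [c] is tuned at each
    use. *)
Lemma dotp_young c u v : 0 < c ->
  2 * dotp u v <= c * dotp u u + c^-1 * dotp v v.
Proof.
move=> c0; have := mulr_ge0 (ltW c0) (dotpp_ge0 (u - c^-1 *: v)).
rewrite !dotpE (dotpC v u).
have -> : c * (dotp u u + - (c^-1 * dotp u v)
    + (- (c^-1 * dotp u v) + - - (c^-1 * (c^-1 * dotp v v))))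
  = c * dotp u u + c^-1 * dotp v v - 2 * dotp u v by field; rewrite gt_eqF.
by rewrite subr_ge0.
Qed.

Lemma dotppD_le u v : dotp (u + v) (u + v) <= 2 * dotp u u + 2 * dotp v v.
Proof.
have := dotp_young u v ltr01; rewrite !dotpE (dotpC v u) invr1; lra.
Qed.

End InnerProduct.

(** * Convexity, the gradient inequality and the descent lemma *)

Section SmoothConvex.
Context {R : realType} {n : nat}.
Implicit Types (f : 'rV[R]_n -> R) (u v x y z d : 'rV[R]_n).

Lemma convex_functionP {f} : convex_function [set: 'rV[R]_n] f ->
  forall (t : R) u v, 0 <= t <= 1 ->
    f (t *: u + (1 - t) *: v) <= t * f u + (1 - t) * f v.
Proof.
move=> fc t u v t01.
have ht : Itv.spec (@Itv.num_sem R) (Itv.Real `[0%Z, 1%Z]) t.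
  by rewrite /= /Itv.num_sem/= num_real/= in_itv/=.
exact: (fc (Itv.mk ht) u v (in_setT _) (in_setT _)).
Qed.

Lemma derive_gradient f x d : differentiable f x ->
  'D_d f x = dotp (gradient f x) d.
Proof.
move=> fx; rewrite deriveE// {1}(row_sum_delta d) linear_sum /dotp.
by apply: eq_bigr => i _; rewrite linearZ mxE deriveE// [RHS]mulrC.
Qed.

Lemma is_derive_line f y d (t : R) : differentiable f (y + t *: d) ->
  is_derive t 1 (fun s : R => f (y + s *: d))
    (dotp (gradient f (y + t *: d)) d).
Proof.
move=> ft.
have lt : is_diff t (fun s : R => y + s *: d) (fun s : R => s *: d).
  have := is_diffD (is_diff_cst y t) (is_diff_scalel t d).
  by rewrite add0r.
have ft' : is_diff (y + t *: d) f ('d f (y + t *: d)) by exact: DiffDef.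
have [c1 c2] := is_diff_comp lt ft'.
apply: DeriveDef; first exact/derivable1_diffP.
by rewrite deriveE// c2/= scale1r -deriveE// derive_gradient.
Qed.

(** By convexity the difference quotients from [y] towards [z], with step in (0, 1], are at most
    [f z - f y]; the bound passes to the limit at 0 from the right. *)
Lemma convex_gradient_le f y z :
  convex_function [set: 'rV[R]_n] f -> differentiable f y ->
  f y + dotp (gradient f y) (z - y) <= f z.
Proof.
move=> fc fy; rewrite -lerBrDl -derive_gradient//.
have dr := cvg_dnbhs_at_right (diff_derivable fy : derivable f y (z - y)).
apply: (cvgr_to_le dr); near=> t.
have t0 : 0 < t by near: t; exact: nbhs_right_gt.
have t1 : t <= 1 by near: t; apply: nbhs_right_le.
rewrite /= -[_ *: (_ - _)]/(t^-1 * _) ler_pdivrMl//.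
have -> : t *: (z - y) + y = t *: z + (1 - t) *: y.
  by rewrite scalerBr scalerBl scale1r -addrA (addrC (- _)).
rewrite lerBlDr.
have /(convex_functionP fc) : 0 <= t <= 1 by rewrite (ltW t0).
by move=> /(_ z y); lra.
Unshelve. all: by end_near. Qed.

Lemma lipschitz2_sqr (g : 'rV[R]_n -> 'rV[R]_n) L x y : lipschitz2 L g ->
  dotp (g x - g y) (g x - g y) <= L ^+ 2 * dotp (x - y) (x - y).
Proof.
move=> /(_ x y) gL; rewrite -!norm2_sqr -exprMn ler_pXn2r// nnegrE ?sqrtr_ge0//.
exact: le_trans (sqrtr_ge0 _) gL.
Qed.

(** Instead of integrating the gradient, subtract the claimed quadratic bound along the segment: the
    difference [p] has nonpositive derivative on (0, 1), hence [p 1 <= p 0]. *)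
Lemma lipschitz_gradient_le f L y z :
  (forall x, differentiable f x) -> lipschitz2 L (gradient f) -> 0 < L ->
  f z <= f y + dotp (gradient f y) (z - y) + L / 2 * dotp (z - y) (z - y).
Proof.
move=> fd fL L0; set d := z - y; set g0 := dotp (gradient f y) d.
set c := L / 2 * dotp d d.
pose p : R -> R := (fun t => f (y + t *: d)) - (g0 *: id + c *: (id ^+ 2)).
have dp (t : R) : is_derive t 1 p (dotp (gradient f (y + t *: d)) d
    - (g0 + 2 * t * c)).
  have fl := is_derive_line (fd (y + t *: d)).
  apply: is_derive_eq; congr (_ - (_ + _)); first exact: mulr1.
  rewrite -[LHS]/(c * (2 * t ^+ 1 * 1)); ring.
have p10 : p 1 <= p 0.
  apply: (@ler0_derive1_nincr _ p 0 1) => //.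
  - move=> t; rewrite in_itv/= => /andP[t0 _].
    rewrite derive1E derive_val /g0.
    have := lipschitz2_sqr (y + t *: d) y fL.
    set w := gradient f (y + t *: d); set w0 := gradient f y.
    rewrite (addrC y) addrK => lip.
    (* With this weight both terms of Young's inequality are at most [L * t * dotp d d], so their
       sum is exactly what is needed. *)
    have cp : 0 < (L * t)^-1 by rewrite invr_gt0 mulr_gt0.
    have := dotp_young (w - w0) d cp; rewrite invrK.
    have := ler_wpM2l (ltW cp) lip;
    have -> : (L * t)^-1 * (L ^+ 2 * dotp (t *: d) (t *: d)) = L * t * dotp d d.
      by rewrite dotpZl dotpZr; field; rewrite !gt_eqF.
    rewrite [dotp (w - w0) d]dotpDl [dotp (- w0) d]dotpNl /c; lra.
  - apply: continuous_subspaceT => t.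
    by apply: differentiable_continuous; apply/derivable1_diffP.
move: p10; rewrite /p/= -[_ <= _]/(f (y + 1 *: d) - (g0 * 1 + c * 1 ^+ 2)
  <= f (y + 0 *: d) - (g0 * 0 + c * 0 ^+ 2)).
rewrite !scale1r scale0r addr0 /d (addrC y) subrK.
rewrite expr1n expr0n/=; lra.
Qed.

(** Used to extract first-order conditions from inequalities along a segment, once they are divided
    by the step [t]. *)
Lemma le0_affine_perturbation (a b : R) :
  (forall t, 0 < t <= 1 -> 0 <= a + t * b) -> 0 <= a.
Proof.
move=> H; rewrite leNgt; apply/negP => a0.
have c0 : 0 < 2 * (`|b| - a) by have := normr_ge0 b; lra.
(* For negative [a] this step keeps [t * b] below [- a / 2], so the sum remains negative. *)
have t01 : 0 < - a / (2 * (`|b| - a)) <= 1.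
  rewrite divr_gt0 ?oppr_gt0// ler_pdivrMr//.
  by have := normr_ge0 b; lra.
have := H _ t01; apply/negP; rewrite -ltNge.
have tb : - a / (2 * (`|b| - a)) * `|b| <= - a / 2.
  rewrite mulrAC ler_pdivrMr//; have := normr_ge0 b; nra.
have : - a / (2 * (`|b| - a)) * b <= - a / (2 * (`|b| - a)) * `|b|.
  by rewrite ler_wpM2l ?ler_norm//; case/andP: t01 => /ltW.
lra.
Qed.

End SmoothConvex.

(** * Optimality conditions and lower bounds for the objective gap *)

Section CompositeObjective.
Context {R : realType} {n : nat} {f : 'rV[R]_n -> R} {g : 'rV[R]_n -> 'rV[R]_n}.
Context {L rho : R} (L_gt0 : 0 < L) (rho_gt0 : 0 < rho).
Context (f_ge : forall y z, f y + dotp (g y) (z - y) <= f z).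
Context (f_le : forall y z,
  f z <= f y + dotp (g y) (z - y) + L / 2 * dotp (z - y) (z - y)).
Implicit Types (u v w x y z : 'rV[R]_n).

Let F x := f x + rho * norm1 x.

(** Compare the lower bound based at [y] with the upper bound based at [z], both at the point [w]
    reached from [z] by a gradient step on [f - dotp (g y)]. *)
Lemma cocoercive y z :
  (2 * L)^-1 * dotp (g z - g y) (g z - g y) <= f z - f y - dotp (g y) (z - y).
Proof.
set a := g z - g y; set w := z - L^-1 *: a.
have := le_trans (f_ge y w) (f_le z w).
have -> : w - z = - L^-1 *: a by rewrite /w addrC addKr scaleNr.
have -> : w - y = (z - y) - L^-1 *: a by rewrite /w addrAC.
have -> : (2 * L)^-1 * dotp a a = L^-1 * dotp a a
    - L / 2 * (L^-1 * (L^-1 * dotp a a)) by field; rewrite gt_eqF.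
rewrite {2 3}/a !dotpE; lra.
Qed.

Lemma norm1_segment (t : R) x z : 0 <= t <= 1 ->
  norm1 (x + t *: (z - x)) <= (1 - t) * norm1 x + t * norm1 z.
Proof.
move=> /andP[t0 t1]; rewrite /norm1 !mulr_sumr -big_split/=.
apply: ler_sum => i _; rewrite !mxE.
have -> : x 0 i + t * (z 0 i - x 0 i) = (1 - t) * x 0 i + t * z 0 i by ring.
apply: (le_trans (ler_normD _ _)).
by rewrite !normrM (ger0_norm t0) ger0_norm ?subr_ge0.
Qed.

Context {xs : 'rV[R]_n} (xs_min : forall z, F xs <= F z).
Let h := g xs.

(** Move from [xs] towards [z] by a fraction [t]: the smooth part is bounded by the descent lemma,
    the l1 part by convexity, and the remainder is of order [t ^+ 2]. *)
Lemma minimizer_variational z :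
  0 <= dotp h (z - xs) + rho * (norm1 z - norm1 xs).
Proof.
apply: (@le0_affine_perturbation _ _ (L / 2 * dotp (z - xs) (z - xs))).
move=> t /andP[t0 t1]; have t01 : 0 <= t <= 1 by rewrite (ltW t0).
rewrite -(pmulr_rge0 _ t0).
have := xs_min (xs + t *: (z - xs)); rewrite /F.
have := f_le xs (xs + t *: (z - xs)).
have := ler_wpM2l (ltW rho_gt0) (norm1_segment xs z t01).
rewrite (addrC xs) addrK -/h !dotpE; lra.
Qed.

(** Test with the vector that differs from [xs] only in coordinate [i], where it equals [s]. *)
Lemma minimizer_variational_coord i (s : R) :
  0 <= h 0 i * (s - xs 0 i) + rho * (`|s| - `|xs 0 i|).
Proof.
have := minimizer_variational (xs + (s - xs 0 i) *: delta_mx 0 i).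
rewrite (addrC xs) addrK dotpZr.
have -> : dotp h (delta_mx 0 i) = h 0 i.
  rewrite /dotp (bigD1 i)//= !mxE !eqxx mulr1 big1 ?addr0// => j ji.
  by rewrite mxE (negbTE ji) andbF mulr0.
have -> : norm1 ((s - xs 0 i) *: delta_mx 0 i + xs) - norm1 xs
    = `|s| - `|xs 0 i|.
  rewrite /norm1 (bigD1 i)//= [X in _ - X](bigD1 i)//= !mxE !eqxx mulr1 subrK.
  rewrite [X in _ + X - _](eq_bigr (fun j => `|xs 0 j|)) => [|j ji].
    by rewrite opprD addrACA subrr addr0.
  by rewrite !mxE (negbTE ji) andbF mulr0 add0r.
by rewrite mulrC.
Qed.

Lemma minimizer_gradient_le i : `|h 0 i| <= rho.
Proof.
rewrite ler_norml; apply/andP; split.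
- have := minimizer_variational_coord i (xs 0 i + 1).
  rewrite (addrC (xs 0 i)) addrK mulr1.
  have := ler_normD 1 (xs 0 i); rewrite normr1 => h1.
  have : rho * (`|1 + xs 0 i| - `|xs 0 i|) <= rho * 1.
    by rewrite ler_wpM2l ?(ltW rho_gt0)//; lra.
  lra.
- have := minimizer_variational_coord i (xs 0 i - 1).
  rewrite (addrC (xs 0 i)) addrK mulrN1.
  have := ler_normD (-1) (xs 0 i); rewrite normrN1 => h1.
  have : rho * (`|-1 + xs 0 i| - `|xs 0 i|) <= rho * 1.
    by rewrite ler_wpM2l ?(ltW rho_gt0)//; lra.
  lra.
Qed.

(** The test values [s = 0] and [s = 2 * xs 0 i] give the two opposite inequalities. *)
Lemma minimizer_complementarity i : rho * `|xs 0 i| + h 0 i * xs 0 i = 0.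
Proof.
have := minimizer_variational_coord i 0; rewrite normr0.
have := minimizer_variational_coord i (2 * xs 0 i).
rewrite normrM gtr0_norm//; lra.
Qed.

Lemma slack_ge x i :
  (rho - `|h 0 i|) * `|x 0 i| <= rho * `|x 0 i| + h 0 i * x 0 i.
Proof.
rewrite mulrBl lerD2l -normrM lerNl -normrN; exact: ler_norm.
Qed.

Lemma minimizer_eq0 i : `|h 0 i| != rho -> xs 0 i = 0.
Proof.
move=> hr; have hlt : 0 < rho - `|h 0 i|.
  by rewrite subr_gt0 lt_neqAle hr minimizer_gradient_le.
have := slack_ge xs i; rewrite minimizer_complementarity pmulr_rle0//.
by rewrite normr_le0 => /eqP.
Qed.

Lemma slack_ge0 x i : 0 <= rho * `|x 0 i| + h 0 i * x 0 i.
Proof.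
apply: le_trans (slack_ge x i).
by rewrite mulr_ge0// subr_ge0 minimizer_gradient_le.
Qed.

(* Both terms on the right are nonnegative: a Bregman distance and the
   complementarity slack. *)
Lemma gapE x : F x - F xs = (f x - f xs - dotp h (x - xs))
  + \sum_i (rho * `|x 0 i| + h 0 i * x 0 i).
Proof.
have : \sum_i (rho * `|xs 0 i| + h 0 i * xs 0 i) = 0.
  by rewrite big1// => i _; exact: minimizer_complementarity.
rewrite !big_split/= -!mulr_sumr /F dotpDr dotpNr /dotp /norm1; lra.
Qed.

Lemma bregman_le_gap x : f x - f xs - dotp h (x - xs) <= F x - F xs.
Proof. by rewrite gapE lerDl sumr_ge0// => i _; exact: slack_ge0. Qed.

(** Of the nonnegative terms in [gapE], only the slack of coordinate [i] is kept. Where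
    [|h_i| < rho], this controls the coordinate by the gap. *)
Lemma coord_le_gap x i : (rho - `|h 0 i|) * `|x 0 i| <= F x - F xs.
Proof.
rewrite gapE (bigD1 i)//= addrCA -[leLHS]addr0; apply: lerD.
  exact: slack_ge.
apply: addr_ge0; last by rewrite sumr_ge0// => j _; exact: slack_ge0.
by have := f_ge xs x; rewrite -/h; lra.
Qed.
End CompositeObjective.

(** * Soft thresholding and the proximal map of the l1 norm *)

Section SoftThresholding.
Context {R : realType} {n : nat}.
Implicit Types (tau t s : R) (w z : 'rV[R]_n).

Definition soft tau t : R :=
  if tau < t then t - tau else if t < - tau then t + tau else 0.

Lemma soft_eq0 tau t : `|t| <= tau -> soft tau t = 0.
Proof.
rewrite ler_norml /soft => /andP[h1 h2].
by rewrite ltNge h2/= ltNge h1.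
Qed.

(** The prox objective is 1-strongly convex, which produces the extra square on the left; that
    square later yields both uniqueness and the three-point inequality. *)
Lemma soft_argmin tau t s : 0 <= tau ->
  2^-1 * (soft tau t - t) ^+ 2 + tau * `|soft tau t|
    + 2^-1 * (s - soft tau t) ^+ 2 <= 2^-1 * (s - t) ^+ 2 + tau * `|s|.
Proof.
move=> tau0; rewrite /soft; case: ltP => h1; last case: ltP => h2.
- rewrite (@ger0_norm _ (t - tau)); last by lra.
  have := ler_wpM2l tau0 (ler_norm s); nra.
- rewrite (@ler0_norm _ (t + tau)); last by lra.
  have := ler_norm (- s); rewrite normrN => /(ler_wpM2l tau0); nra.
- have := ler_norm (t * s); rewrite normrM normr0 => h3.
  have : `|t| * `|s| <= tau * `|s| by rewrite ler_wpM2r// ler_norml h1 h2.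
  nra.
Qed.

Lemma prox_norm1 tau w : 0 <= tau ->
  prox (fun z => tau * norm1 z) w = \row_i soft tau (w 0 i).
Proof.
move=> tau0; set p : 'rV[R]_n := \row_i soft tau (w 0 i).
have pz z : 2^-1 * norm2 (p - w) ^+ 2 + tau * norm1 p
    + 2^-1 * dotp (z - p) (z - p) <= 2^-1 * norm2 (z - w) ^+ 2 + tau * norm1 z.
  rewrite !norm2_sqr /dotp /norm1 !mulr_sumr -!big_split/=.
  by apply: ler_sum => i _; rewrite !mxE -!expr2; exact: soft_argmin.
apply: xget_unique => [z|z zmin].
  by apply: le_trans (pz z); rewrite lerDl mulr_ge0 ?dotpp_ge0// invr_ge0.
have := pz z; have := zmin p; rewrite /= => h1 h2.
by apply/eqP; rewrite -subr_eq0; apply/eqP/dotpp_le0; lra.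
Qed.

Lemma prox_norm1_variational tau w z : 0 <= tau ->
  let p := prox (fun z => tau * norm1 z) w in
  2^-1 * dotp (p - w) (p - w) + tau * norm1 p + 2^-1 * dotp (z - p) (z - p)
    <= 2^-1 * dotp (z - w) (z - w) + tau * norm1 z.
Proof.
move=> tau0; rewrite /= prox_norm1//.
rewrite /dotp /norm1 !mulr_sumr -!big_split/=.
by apply: ler_sum => i _; rewrite !mxE -!expr2; exact: soft_argmin.
Qed.

End SoftThresholding.

(** * Limits and decay of real sequences *)

Lemma nonincreasing_increment_small (R : realType) (e w : nat -> R) (c : R) :
  0 < c -> (forall k, 0 <= e k) -> (forall k, e k.+1 + c * w k <= e k) ->
  (forall k, 0 <= w k) ->
  forall eta, 0 < eta -> \forall k \near \oo, w k <= eta.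
Proof.
move=> c0 e0 ew w0 eta eta0.
have nie : nonincreasing_seq e.
  apply/nonincreasing_seqP => k; apply: le_trans (ew k).
  by rewrite lerDl mulr_ge0// ltW.
have cve : cvgn e.
  by apply: nonincreasing_is_cvgn => //; exists 0 => _ [k _ <-].
have lt : lim (e @ \oo) < lim (e @ \oo) + c * eta by rewrite ltrDl mulr_gt0.
near=> k.
have ek : e k <= lim (e @ \oo) + c * eta.
  by near: k; exact: (cvgr_le _ cve).
rewrite -(ler_pM2l c0).
have := nonincreasing_cvgn_ge nie cve k.+1; have := ew k; lra.
Unshelve. all: by end_near. Qed.

(** The bound starts strictly after [N] so that [r = 0] is covered: then [V k <= 0] for [k > N],
    while [V N] may be positive. *)
Lemma geometric_decay (R : realType) (V : nat -> R) (r : R) (N : nat) :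
  0 <= r -> (forall k, (N <= k)%N -> V k.+1 <= r * V k) ->
  exists2 C, 0 <= C & forall k, (N < k)%N -> V k <= C * r ^+ k.
Proof.
rewrite le_eqVlt => /predU1P[<-|r0] VS.
  exists 0 => // -[//|k] Nk.
  by rewrite mul0r; apply: le_trans (VS k Nk) _; rewrite mul0r.
exists (`|V N| / r ^+ N); first by rewrite divr_ge0// exprn_ge0 ?ltW.
move=> k /ltnW; elim: k => [|k IH].
  by rewrite leqn0 => /eqP->; rewrite expr0 divr1 mulr1 ler_norm.
rewrite leq_eqVlt => /predU1P[<-|Nk].
  by rewrite divfK ?expf_neq0 ?gt_eqF// ler_norm.
apply: le_trans (VS k Nk) _; rewrite exprS mulrCA.
by rewrite ler_pM2l// IH.
Qed.

Lemma near_infty_shift (P : nat -> Prop) :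
  (\forall k \near \oo, P k) -> \forall k \near \oo, P k.+1.
Proof. by case=> N _ PN; exists N => // k /leqW; exact: PN. Qed.

(** * Vectors supported on an index set, and strong convexity there *)

Section Support.
Context {R : realType} {n : nat}.
Implicit Types (E : {set 'I_n}) (u v : 'rV[R]_n).

Definition supported_on E u := forall i, i \notin E -> u 0 i = 0.

Lemma restrict_setK E u : supported_on E u -> extend0 (restrict_set E u) = u.
Proof.
move=> uE; apply/rowP => i; rewrite mxE.
have [iE|iE] := boolP (i \in E).
  rewrite (big_pred1 (enum_rank_in iE i)) => [|j].
    by rewrite mxE enum_rankK_in.
  by rewrite -[RHS](inj_eq enum_val_inj) enum_rankK_in.
rewrite uE// big_pred0// => j; apply: contraNF iE => /eqP <-.
exact: enum_valP.
Qed.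

Lemma dotp_restrict_set E u v : supported_on E v ->
  dotp (restrict_set E u) (restrict_set E v) = dotp u v.
Proof.
move=> vE; rewrite /dotp [RHS](bigID (mem E))/=.
rewrite [X in _ = _ + X]big1 ?addr0 => [|i iE]; last by rewrite vE ?mulr0.
rewrite [RHS]big_enum_val.
by apply: eq_bigr => j _; rewrite !mxE.
Qed.

Lemma restrict_set_segment E (t : R) u v :
  restrict_set E (t *: u + (1 - t) *: v)
    = t *: restrict_set E u + (1 - t) *: restrict_set E v.
Proof. by apply/rowP => j; rewrite !mxE. Qed.

Lemma supported_segment E (t : R) u v : supported_on E u -> supported_on E v ->
  supported_on E (t *: u + (1 - t) *: v).
Proof. by move=> uE vE i iE; rewrite !mxE uE// vE// !mulr0 addr0. Qed.

(* On vectors supported in E, f and phi differ by a linear function. *)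
Lemma modulus_convex_first_order E (f : 'rV[R]_n -> R) (h : 'rV[R]_n) (m : R) :
  convex_function [set: 'rV[R]_n] f -> (forall x, differentiable f x) ->
  modulus_convex m (fun u : 'rV[R]_#|E| =>
    - dotp (restrict_set E h) u + f (extend0 u)) ->
  forall u v, supported_on E u -> supported_on E v ->
    f u + dotp (gradient f u) (v - u) + m / 2 * dotp (v - u) (v - u) <= f v.
Proof.
move=> fc fd /convex_functionP mc u v uE vE.
rewrite -subr_ge0.
apply: (@le0_affine_perturbation _ _ (m / 2 * dotp (v - u) (v - u))).
move=> t /andP[t0 t1]; rewrite -(pmulr_rge0 _ t0).
have wE := supported_segment t vE uE.
have t01 : 0 <= t <= 1 by rewrite ltW.
have := mc t (restrict_set E v) (restrict_set E u) t01.
rewrite -restrict_set_segment !norm2_sqr !restrict_setK// !dotp_restrict_set//.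
(* This bounds from below the value of [f] at the point of the segment; the linear terms in [h]
   cancel and a factor [t] remains throughout. *)
have := convex_gradient_le (t *: v + (1 - t) *: u) fc (fd u).
have -> : t *: v + (1 - t) *: u - u = t *: (v - u).
  by apply/rowP => i; rewrite !mxE; ring.
rewrite !dotpE (dotpC v u); lra.
Qed.

End Support.

(** * One proximal gradient step: descent, growth, support and contraction *)

Section ProximalGradient.
Context {R : realType} {n : nat} {f : 'rV[R]_n -> R} {g : 'rV[R]_n -> 'rV[R]_n}.
Context {L rho : R} (L_gt0 : 0 < L) (rho_gt0 : 0 < rho).
Context (f_ge : forall y z, f y + dotp (g y) (z - y) <= f z).
Context (f_le : forall y z,
  f z <= f y + dotp (g y) (z - y) + L / 2 * dotp (z - y) (z - y)).
Context (g_lip : lipschitz2 L g).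
Context {lambda : R} (lambda_gt0 : 0 < lambda) (lambda_le : lambda * L <= 1).
Implicit Types (u v w x y z : 'rV[R]_n).

Let F x := f x + rho * norm1 x.

Definition prox_grad y :=
  prox (fun z => lambda * rho * norm1 z) (y - lambda *: g y).

(** Adds the three-point inequality of the prox, the descent lemma from [y] to the new point and the
    lower bound at [z]; [lambda * L <= 1] absorbs the descent remainder. It is used with [m = 0] in
    general and with the strong convexity modulus on vectors supported in [E]. *)
Lemma prox_grad_le m y z :
  f y + dotp (g y) (z - y) + m / 2 * dotp (z - y) (z - y) <= f z ->
  lambda * F (prox_grad y)
    + 2^-1 * dotp (z - prox_grad y) (z - prox_grad y)
  <= lambda * F z + (1 - lambda * m) / 2 * dotp (z - y) (z - y).
Proof.
have lr : 0 <= lambda * rho by rewrite mulr_ge0 ?ltW.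
have := prox_norm1_variational (y - lambda *: g y) z lr.
rewrite /= -/(prox_grad y); set p := prox_grad y => hp fz.
have := ler_wpM2l (ltW lambda_gt0) (f_le y p).
have := ler_wpM2l (ltW lambda_gt0) fz.
have : lambda * L * dotp (p - y) (p - y) <= 1 * dotp (p - y) (p - y).
  by rewrite ler_wpM2r ?dotpp_ge0.
have E w : dotp (w - (y - lambda *: g y)) (w - (y - lambda *: g y))
  = dotp (w - y) (w - y) + 2 * (lambda * dotp (g y) (w - y))
    + lambda * (lambda * dotp (g y) (g y)).
  by rewrite opprB addrCA addrC !(dotpDl, dotpDr, dotpZl, dotpZr)
       !(dotpC _ (g y)); ring.
move: hp; rewrite !E /F; lra.
Qed.

Context {xs : 'rV[R]_n} (xs_min : forall z, F xs <= F z).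
Let h := g xs.
Let gap x := F x - F xs.

Let gap_ge0 x : 0 <= gap x. Proof. by rewrite subr_ge0. Qed.

Context {E : {set 'I_n}} {delta m : R} (delta_gt0 : 0 < delta) (m_gt0 : 0 < m).
Context (delta_le : forall i, i \notin E -> delta <= rho - `|h 0 i|).

Context (f_sc : forall u v, supported_on E u -> supported_on E v ->
  f u + dotp (g u) (v - u) + m / 2 * dotp (v - u) (v - u) <= f v).

Lemma minimizer_supported : supported_on E xs.
Proof.
move=> i iE; apply: (minimizer_eq0 rho_gt0 f_le xs_min).
by have := delta_le iE; apply: contraTneq => ->; rewrite subrr -ltNge.
Qed.

Lemma off_support_le x i : i \notin E -> `|x 0 i| <= gap x / delta.
Proof.
move=> iE; rewrite ler_pdivlMr// mulrC.
apply: le_trans (coord_le_gap rho_gt0 f_ge f_le xs_min x i).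
by rewrite ler_wpM2r// delta_le.
Qed.

(** Let [z] be [x] with the coordinates off [E] set to 0. Strong convexity controls [z - xs], and
    [off_support_le] controls [x - z]. Passing from [f z] to [f x] costs a gradient cross term,
    handled by Young and cocoercivity. This bounds the sublevel sets and makes the minimizer
    unique. *)
Lemma gap_growth x : m / 2 * dotp (x - xs) (x - xs) <=
  2 * gap x + (L + m / 2) * (n%:R * (gap x / delta) ^+ 2).
Proof.
pose z : 'rV[R]_n := \row_i (if i \in E then x 0 i else 0).
have zE : supported_on E z by move=> i iE; rewrite mxE (negbTE iE).
have xz : dotp (x - z) (x - z) <= n%:R * (gap x / delta) ^+ 2.
  rewrite -[n in n%:R]card_ord -sumr_const mulr_suml.
  apply: ler_sum => i _; rewrite mul1r !mxE -expr2; case: ifPn => iE.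
    by rewrite subrr expr0n sqr_ge0.
  rewrite subr0 -real_normK ?num_real//.
  rewrite ler_sqr ?nnegrE// ?off_support_le//.
  by rewrite divr_ge0 ?gap_ge0 ?ltW.
have xE : dotp (x - xs) (x - xs)
    = dotp (z - xs) (z - xs) + dotp (x - z) (x - z).
  rewrite /dotp -big_split/=; apply: eq_bigr => i _; rewrite !mxE.
  by case: ifPn => iE; rewrite ?(minimizer_supported iE); ring.
have := f_sc minimizer_supported zE.
have := f_le x z.
have := cocoercive L_gt0 f_ge f_le xs x.
have := bregman_le_gap rho_gt0 f_le xs_min x.
have := dotp_young (g x - h) (z - x) (_ : 0 < L^-1).
rewrite invr_gt0 L_gt0 invrK => /(_ isT).
have -> : dotp (z - x) (z - x) = dotp (x - z) (x - z).
  by rewrite -(opprB x z) !dotpE; ring.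
have -> : dotp (g xs) (z - xs) = dotp h (x - xs) + dotp h (z - x).
  by rewrite -dotpDr (addrC (x - xs)) addrA subrK.
rewrite [dotp (g x - h) (z - x)]dotpDl [dotp (- h) (z - x)]dotpNl.
rewrite xE -/h -/(gap x) invfM.
have : 0 <= L + m / 2 by rewrite addr_ge0 ?divr_ge0 ?ltW.
move=> /ler_wpM2l/(_ _ _ xz).
set A := (L + m / 2) * (n%:R * _); lra.
Qed.


(** Off [E], [lambda * |h_i|] lies below the threshold by at least [lambda * delta]. The rest of the
    gradient step splits into four terms, each allowed a quarter [kappa] of this margin. *)
Lemma off_support_threshold : exists2 eta, 0 < eta & forall x y,
  dotp (y - x) (y - x) <= eta -> gap x <= eta ->
  forall i, i \notin E -> `|(y - lambda *: g y) 0 i| <= lambda * rho.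
Proof.
pose kappa := lambda * delta / 4.
have kappa0 : 0 < kappa by rewrite divr_gt0 ?mulr_gt0.
have kappa2 : 0 < kappa ^+ 2 by rewrite exprn_gt0.
(* The three bounds control, in order, [y - x] together with the gradient change from [x] to [y],
   the coordinate of [x], and [lambda *: (g x - h)] through cocoercivity. *)
pose eta := Num.min (kappa ^+ 2)
  (Num.min (kappa * delta) (kappa ^+ 2 / (2 * lambda))).
exists eta; first by rewrite !lt_min kappa2 mulr_gt0 ?divr_gt0 ?mulr_gt0.
move=> x y; rewrite !le_min => /andP[yx _] /and3P[_ gx1 gx2] i iE.
have h1 : `|(y - x) 0 i| <= kappa by exact: normr_coord_le (ltW kappa0) yx.
have h2 : `|x 0 i| <= kappa.
  by apply: le_trans (off_support_le x iE) _; rewrite ler_pdivrMr.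
have h3 : `|(lambda *: (g y - g x)) 0 i| <= kappa.
  apply: normr_coord_le (ltW kappa0) _; rewrite dotpZl dotpZr.
  apply: le_trans yx.
  have lL : 0 <= lambda * L by rewrite mulr_ge0 ?ltW.
  have : lambda * (lambda * dotp (g y - g x) (g y - g x)) <=
      (lambda * L) ^+ 2 * dotp (y - x) (y - x).
    have := ler_wpM2l (sqr_ge0 lambda) (lipschitz2_sqr y x g_lip).
    lra.
  move=> /le_trans; apply; rewrite -[leRHS]mul1r ler_wpM2r ?dotpp_ge0//.
  exact: exprn_ile1.
have h4 : `|(lambda *: (g x - h)) 0 i| <= kappa.
  apply: normr_coord_le (ltW kappa0) _; rewrite dotpZl dotpZr.
  have := le_trans (cocoercive L_gt0 f_ge f_le xs x)
    (bregman_le_gap rho_gt0 f_le xs_min x).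
  rewrite -/h -/(gap x) ler_pdivrMl ?mulr_gt0// => gh.
  move: gx2; rewrite ler_pdivlMr ?mulr_gt0// => gx2.
  have := ler_wpM2l (sqr_ge0 lambda) gh.
  have : 0 <= (1 - lambda * L) * (2 * lambda * gap x).
    by rewrite !mulr_ge0 ?gap_ge0 ?subr_ge0// ltW.
  lra.
have h5 : `|(lambda *: h) 0 i| <= lambda * rho - 4 * kappa.
  rewrite mxE normrM gtr0_norm//.
  by have := ler_wpM2l (ltW lambda_gt0) (delta_le iE); rewrite /kappa; lra.
have -> : (y - lambda *: g y) 0 i = (y - x) 0 i + x 0 i
    - (lambda *: (g y - g x)) 0 i - (lambda *: (g x - h)) 0 i
    - (lambda *: h) 0 i by rewrite !mxE; ring.
move: h1 h2 h3 h4 h5; rewrite !ler_norml; lra.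
Qed.

(** The vector being squared equals [x1 - (q *: xs + (1 - q) *: x0)], the offset of [x1] from the
    comparison point built on the previous iterate. *)
Definition lyapunov (q : R) x0 x1 := lambda * gap x1
  + 2^-1 * dotp (q *: (x1 - xs) + (1 - q) *: (x1 - x0))
      (q *: (x1 - xs) + (1 - q) *: (x1 - x0)).

(** Apply the first-order bound at the intermediate point [z] towards both ends; in the weighted sum
    the gradient terms cancel. *)
Lemma segment_strongly_convex (t : R) u v :
  supported_on E u -> supported_on E v -> 0 <= t <= 1 ->
  F (t *: u + (1 - t) *: v) <= t * F u + (1 - t) * F v
    - m / 2 * (t * (1 - t)) * dotp (v - u) (v - u).
Proof.
move=> uE vE /andP[t0 t1]; set z := t *: u + _.
have zE : supported_on E z by exact: supported_segment.
have zv : z = v + t *: (u - v).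
  by apply/rowP => i; rewrite !mxE; ring.
have : norm1 z <= (1 - t) * norm1 v + t * norm1 u.
  by rewrite zv norm1_segment// t0.
move=> /(ler_wpM2l (ltW rho_gt0)).
have := f_sc zE uE; have := f_sc zE vE.
have -> : v - z = t *: (v - u) by apply/rowP => i; rewrite !mxE; ring.
have -> : u - z = - (1 - t) *: (v - u).
  by apply/rowP => i; rewrite !mxE; ring.
have t1' : 0 <= 1 - t by rewrite subr_ge0.
move=> /(ler_wpM2l t1') hv /(ler_wpM2l t0) hu.
move: hv hu; rewrite !(dotpZl, dotpZr) /F; lra.
Qed.

Lemma gap_quadratic_growth x : supported_on E x ->
  m / 2 * dotp (x - xs) (x - xs) <= gap x.
Proof.
move=> xE; apply: le_trans (bregman_le_gap rho_gt0 f_le xs_min x).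
have := f_sc minimizer_supported xE; lra.
Qed.

(* The proximal inequality at z = q xs + (1 - q) x1; note that
   q (p - xs) + (1 - q) (p - x1) = p - z. *)
Lemma lyapunov_contraction (q alpha : R) x0 x1 :
  0 < q <= 1 -> q ^+ 2 = m * lambda -> alpha = (1 - q) / (1 + q) ->
  let y := x1 + alpha *: (x1 - x0) in
  supported_on E x0 -> supported_on E x1 ->
  lyapunov q x1 (prox_grad y) <= (1 - q) * lyapunov q x0 x1.
Proof.
move=> /andP[q0 q1] q2 aE y x0E x1E.
have aq : alpha * (1 + q) = 1 - q by rewrite aE divfK// gt_eqF// addr_gt0.
have a0 : 0 <= alpha by rewrite aE divr_ge0 ?subr_ge0// addr_ge0 ?ltW.
set p := prox_grad y; set z := q *: xs + (1 - q) *: x1.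
have yE : supported_on E y.
  by move=> i iE; rewrite !mxE x1E// x0E// subr0 mulr0 addr0.
have zE : supported_on E z := supported_segment q minimizer_supported x1E.
have q01 : 0 <= q <= 1 by rewrite (ltW q0).
have := segment_strongly_convex minimizer_supported x1E q01.
rewrite -/z => /(ler_wpM2l (ltW lambda_gt0)).
have := prox_grad_le (f_sc yE zE); rewrite -/p /lyapunov.
have -> : q *: (p - xs) + (1 - q) *: (p - x1) = - (z - p).
  by apply/rowP => i; rewrite /z !mxE; ring.
have -> : z - y = - (q *: (x1 - xs) + alpha *: (x1 - x0)).
  by apply/rowP => i; rewrite /z /y !mxE; ring.
rewrite (dotpNl (z - p)) (dotpNr (z - p)) opprK.
move: (x1 - xs) (x1 - x0) => a d.
rewrite (mulrC lambda m) -q2.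
rewrite [dotp (- _) _]dotpNl [dotp _ (- _)]dotpNr opprK.
have dd := dotpp_ge0 d.
rewrite !dotpE (dotpC d a).
move: (dotp a a) (dotp a d) (dotp d d) dd => aa ad dd dd0.
(* The two sides agree in [aa] and [ad]; the coefficients of [dd] differ by half of this nonnegative
   factor. The identities below put the products in a common form, using [q ^+ 2 = m * lambda] and
   [alpha * (1 + q) = 1 - q]. *)
have : 0 <= (1 - q) * (1 - q) * (alpha * q) * dd.
  by rewrite !mulr_ge0 ?subr_ge0// ltW.
have e1 : lambda * (m / 2 * (q * (1 - q)) * aa)
    = q ^+ 2 / 2 * (q * (1 - q)) * aa.
  by rewrite q2; ring.
have e2 : (1 - q ^+ 2) * (q * (alpha * ad)) = (1 - q) * (1 - q) * q * ad.
  by rewrite -{2}aq; ring.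
have e3 : (1 - q ^+ 2) * (alpha * (alpha * dd))
    = (1 - q) * (1 - q) * alpha * dd.
  by rewrite -{2}aq; ring.
have e4 : (1 - q) * (1 - q) * (1 - q - alpha - alpha * q) * dd = 0.
  by rewrite -{3}aq; ring.
rewrite /gap; lra.
Qed.

(** * The accelerated iteration: vanishing increments, finite identification of the support,
    decay *)

Section Iterates.
Context {alpha : R} (alpha_ge0 : 0 <= alpha) (alpha_lt1 : alpha < 1).
Context {x y : nat -> 'rV[R]_n}.
Context (yE : forall k, y k.+2 = x k.+1 + alpha *: (x k.+1 - x k)).
Context (xE : forall k, x k.+2 = prox_grad (y k.+2)).

Let energy k := lambda * gap (x k.+1)
  + 2^-1 * dotp (x k.+1 - x k) (x k.+1 - x k).

(** The proximal inequality at the previous iterate [x k.+1], whose distance to [y k.+2] is [alpha]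
    times the last increment. *)
Lemma energy_decrease k :
  energy k.+1 + (1 - alpha ^+ 2) / 2 * dotp (x k.+1 - x k) (x k.+1 - x k)
    <= energy k.
Proof.
have := @prox_grad_le 0 (y k.+2) (x k.+1).
rewrite mul0r mul0r addr0 => /(_ (f_ge _ _)); rewrite -xE /energy.
have -> : x k.+1 - y k.+2 = - (alpha *: (x k.+1 - x k)).
  by rewrite yE opprD addNKr.
have -> : x k.+1 - x k.+2 = - (x k.+2 - x k.+1) by rewrite opprB.
rewrite !(dotpZl, dotpZr, dotpNl, dotpNr) /gap; lra.
Qed.

Let alpha2 : 0 < (1 - alpha ^+ 2) / 2.
Proof. by rewrite divr_gt0// subr_gt0 expr_lt1. Qed.

Let energy_ge0 k : 0 <= energy k.
Proof.
rewrite /energy addr_ge0 ?mulr_ge0 ?gap_ge0 ?dotpp_ge0 ?invr_ge0//.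
exact: ltW.
Qed.

Lemma increment_small eta : 0 < eta ->
  \forall k \near \oo, dotp (x k.+1 - x k) (x k.+1 - x k) <= eta.
Proof.
apply: (nonincreasing_increment_small alpha2 energy_ge0 energy_decrease) => k.
exact: dotpp_ge0.
Qed.

(** The energy never increases and dominates [lambda * gap], so the gap is bounded; [gap_growth]
    turns this into a bound on the distance to [xs]. *)
Lemma iterates_bounded :
  exists2 B, 0 < B & forall k, dotp (x k.+1 - xs) (x k.+1 - xs) <= B.
Proof.
pose C := energy 0 / lambda.
have gC k : gap (x k.+1) <= C.
  rewrite ler_pdivlMr// mulrC.
  have le0 : energy k <= energy 0.
    elim: k => // k; apply: le_trans; apply: le_trans (energy_decrease k).
    by rewrite lerDl mulr_ge0 ?dotpp_ge0 ?ltW.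
  by apply: le_trans le0; rewrite lerDl mulr_ge0 ?dotpp_ge0// invr_ge0.
have C0 : 0 <= C := le_trans (gap_ge0 (x 1)) (gC 0).
pose B := 2 * C + (L + m / 2) * (n%:R * (C / delta) ^+ 2).
have Lm : 0 <= L + m / 2 by rewrite addr_ge0 ?ltW ?divr_gt0.
have m2 : 0 < m / 2 by rewrite divr_gt0.
have B0 : 0 <= B.
  apply: addr_ge0; first exact: mulr_ge0.
  apply: (mulr_ge0 Lm); apply: mulr_ge0 => //; exact: sqr_ge0.
(* The added 1 makes the bound positive, so that it can serve as a divisor. *)
exists (B / (m / 2) + 1); first by rewrite ltr_wpDl ?(divr_ge0 B0 (ltW m2)).
move=> k; suff : dotp (x k.+1 - xs) (x k.+1 - xs) <= B / (m / 2).
  by move=> /le_trans; apply; rewrite lerDl.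
rewrite ler_pdivlMr// mulrC; apply: le_trans (gap_growth _) _.
apply: lerD; first by rewrite ler_pM2l.
apply: ler_wpM2l => //; apply: ler_wpM2l => //.
have gd : gap (x k.+1) / delta <= C / delta by rewrite ler_pM2r ?invr_gt0.
by rewrite ler_pXn2r// nnegrE divr_ge0 ?gap_ge0// ltW.
Qed.

(** The proximal inequality at [xs] bounds [lambda * gap] by half the difference of two squared
    distances to [xs], from [y k.+2] and from [x k.+2]. These points come together while the
    distances stay bounded. *)
Lemma gap_small eta : 0 < eta -> \forall k \near \oo, gap (x k.+2) <= eta.
Proof.
have [B B0 xB] := iterates_bounded; move=> eta0.
(* [eps] and [r] are chosen so that [eps * B] and [(1 + eps^-1) * (4 * r)] both equal
   [lambda * eta]. *)
pose eps := lambda * eta / B.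
have eps0 : 0 < eps by rewrite divr_gt0 ?mulr_gt0.
pose r := lambda * eta / (1 + eps^-1) / 4.
have r0 : 0 < r.
  by rewrite !divr_gt0 ?mulr_gt0 ?addr_gt0 ?invr_gt0.
have W1 := near_infty_shift (increment_small r0).
near=> k.
have w0 : dotp (x k.+1 - x k) (x k.+1 - x k) <= r.
  by near: k; exact: increment_small.
have w1 : dotp (x k.+2 - x k.+1) (x k.+2 - x k.+1) <= r.
  by near: k; exact: W1.
(* Here [q] is a vector; it combines two successive increments. *)
pose q := y k.+2 - x k.+2; pose a := xs - x k.+2.
have qr : dotp q q <= 4 * r.
  have -> : q = - (x k.+2 - x k.+1) + alpha *: (x k.+1 - x k).
    by rewrite /q yE opprB addrAC.
  apply: le_trans (dotppD_le _ _) _.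
  rewrite !(dotpZl, dotpZr, dotpNl, dotpNr) opprK.
  have := dotpp_ge0 (x k.+1 - x k); set w := dotp _ _ in w0 *.
  have : alpha * (alpha * w) <= w.
    by rewrite -[leRHS]mul1r mulrA ler_wpM2r ?dotpp_ge0// mulr_ile1// ltW.
  lra.
have aB : dotp a a <= B.
  by have := xB k.+1; rewrite -(opprB xs) dotpNl dotpNr opprK.
have := @prox_grad_le 0 (y k.+2) xs.
rewrite mul0r mul0r addr0 => /(_ (f_ge _ _)); rewrite -xE.
have -> : xs - y k.+2 = a - q by apply/rowP => i; rewrite /a /q !mxE; ring.
rewrite -/a mulr0 subr0; clearbody a q.
rewrite [dotp (a - q) _]dotpDl !(dotpDr, dotpNl, dotpNr).
have ei0 : 0 < eps^-1 by rewrite invr_gt0.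
have := dotp_young (- q) a ei0; rewrite invrK (dotpC a q).
rewrite !(dotpNl, dotpNr) opprK.
have : eps * dotp a a <= lambda * eta.
  have -> : lambda * eta = eps * B by rewrite /eps divfK ?gt_eqF.
  by rewrite ler_pM2l.
have : (1 + eps^-1) * dotp q q <= lambda * eta.
  have -> : lambda * eta = (1 + eps^-1) * (4 * r).
    by rewrite /r; field; rewrite !gt_eqF// addr_gt0.
  by rewrite ler_pM2l// addr_gt0.
move=> h1 h2 h3 h4; rewrite -(ler_pM2l lambda_gt0) /gap; lra.
Unshelve. all: by end_near. Qed.

(** Once increments and gap are below the threshold [eta], soft thresholding returns exactly 0 off
    [E]. *)
Lemma eventually_supported : \forall k \near \oo, supported_on E (x k).
Proof.
have [eta eta0 etaP] := off_support_threshold.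
suff : \forall k \near \oo, supported_on E (x k.+3).
  case=> N _ HN; exists N.+3 => // -[|[|[|k]]]//= Nk; exact: HN.
have W1 := near_infty_shift (increment_small eta0).
have G := gap_small eta0; near=> k.
have w1 : dotp (x k.+2 - x k.+1) (x k.+2 - x k.+1) <= eta.
  by near: k; exact: W1.
have gk : gap (x k.+2) <= eta by near: k; exact: G.
move=> i iE; rewrite xE /prox_grad prox_norm1 ?mulr_ge0 ?ltW// mxE.
apply: soft_eq0; apply: (etaP (x k.+2)) => //.
rewrite yE (addrC (x k.+2)) addrK dotpZl dotpZr mulrA.
apply: le_trans w1; rewrite -[leRHS]mul1r ler_wpM2r ?dotpp_ge0//.
by rewrite mulr_ile1// ltW.
Unshelve. all: by end_near. Qed.

Lemma gap_geometric (q : R) : 0 < q <= 1 -> q ^+ 2 = m * lambda ->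
  alpha = (1 - q) / (1 + q) ->
  exists2 C, 0 <= C & \forall k \near \oo, gap (x k) <= C * (1 - q) ^+ k.
Proof.
move=> q01 q2 aE; have q1 : 0 <= 1 - q by case/andP: q01; rewrite subr_ge0.
have [N _ xN] := eventually_supported.
(* The contraction is used only from [N.+1] on, where both [x k.-1] and [x k] are supported in
   [E]. *)
pose V k := lyapunov q (x k.-1) (x k).
have VS k : (N.+1 <= k)%N -> V k.+1 <= (1 - q) * V k.
  case: k => // k Nk; rewrite /V/= xE yE.
  by apply: lyapunov_contraction => //; apply: xN => //=; exact: leqW.
have [C C0 VC] := geometric_decay q1 VS.
exists (C / lambda); first by rewrite divr_ge0// ltW.
exists N.+2 => // k /= /VC VCk.
rewrite mulrAC ler_pdivlMr// mulrC; apply: le_trans VCk.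
by rewrite lerDl mulr_ge0 ?dotpp_ge0// invr_ge0.
Qed.

End Iterates.
End ProximalGradient.

(** * From the standing hypotheses to the convergence rates *)

Lemma uniform_slack (R : realType) (I : finType) (P : pred I) (c : I -> R) :
  (forall i, P i -> 0 < c i) ->
  exists2 delta, 0 < delta & forall i, P i -> delta <= c i.
Proof.
(* The default 1 keeps the minimum positive when no index satisfies [P]. *)
move=> c0; exists (\big[Num.min/1]_(i | P i) c i).
  by apply: lt_bigmin => // i; exact: c0.
by move=> i Pi; exact: bigmin_le_cond.
Qed.

(** In dimension 0 the norm vanishes and [l + 1] qualifies as well, against maximality. Applied to
    [phi], this makes [E] nonempty. *)
Lemma strong_convexity_parameter_dim (R : realType) n (phi : 'rV[R]_n -> R) l :
  strong_convexity_parameter phi l -> (0 < n)%N.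
Proof.
move=> [l0 lc lmax]; rewrite lt0n; apply/eqP => n0.
have l1 : modulus_convex (l + 1) phi.
  rewrite /modulus_convex [X in convex_function _ X](_ : _ =
    fun x => phi x - l / 2 * norm2 x ^+ 2)//.
  apply/funext => x.
  have -> : norm2 x = 0.
    by rewrite /norm2 big1 ?sqrtr0// => i; have := ltn_ord i; rewrite {2}n0.
  by rewrite expr0n/= !mulr0.
by have := lmax (l + 1) (addr_gt0 l0 ltr01) l1; rewrite gerDl ler10.
Qed.

Lemma linear_rateP (R : realType) (q C : R) (e : nat -> R) :
  (\forall k \near \oo, `|e k| <= C * `|q ^+ k|) -> linear_rate q e.
Proof.
move=> eC; apply/eqO_exP; exists (`|C| + 1); first by rewrite ltr_wpDl.
apply: filterS eC => k /le_trans; apply.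
rewrite ler_wpM2r//; have := ler_norm C; lra.
Qed.

Theorem corollary2 (R : realType) (n : nat) (f : 'rV[R]_n -> R) (L rho : R)
    (f_convex : convex_function [set: 'rV[R]_n] f)
    (f_diff : forall x, differentiable f x)
    (L_gt0 : 0 < L)
    (f_lip : lipschitz2 L (gradient f))
    (rho_gt0 : 0 < rho) :
  let F := fun x => f x + rho * norm1 x in
  let Fstar := inf (range F) in
  let Xstar := [set x | F x = Fstar] in
  forall (F_lbound : has_lbound (range F)) (Xstar_neq0 : Xstar !=set0)
    (h : 'rV[R]_n) (hE : forall x, Xstar x -> gradient f x = h),
  let E : {set 'I_n} := [set i | `|h 0 i| == rho]%SET in
  let phi := fun u : 'rV[R]_#|E| =>
    - dotp (restrict_set E h) u + f (extend0 u) in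
  forall (phi_sc : strongly_convex phi)
    (lE : R) (lE_param : strong_convexity_parameter phi lE)
    (lambda mu : R)
    (lambda_gt0 : 0 < lambda) (lambda_le : lambda <= 1 / L)
    (mu_gt0 : 0 < mu) (mu_le : mu <= lE)
    (lambda_ alpha_ : nat -> R)
    (lambda_E : forall k, (1 <= k)%N -> lambda_ k = lambda)
    (alpha_E : forall k, (1 <= k)%N ->
      alpha_ k =
        (1 - Num.sqrt (mu * lambda)) / (1 + Num.sqrt (mu * lambda)))
    (x y : nat -> 'rV[R]_n)
    (yE : forall k, (1 <= k)%N ->
      y k.+1 = x k + alpha_ k *: (x k - x k.-1))
    (xE : forall k, (1 <= k)%N ->
      x k.+1 = prox (fun z => lambda_ k * rho * norm1 z)
                    (y k.+1 - lambda_ k *: gradient f (y k.+1))),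
  exists xstar : 'rV[R]_n,
    [/\ argmin F = [set xstar],
        R_linear_cvg (fun u v => norm2 (u - v)) x xstar,
        R_linear_cvg (fun a b : R => `|a - b|) (fun k => F (x k)) Fstar,
        linear_rate (1 - Num.sqrt (mu * lambda))
          (fun k => norm2 (x k - xstar) ^+ 2) &
        linear_rate (1 - Num.sqrt (mu * lambda))
          (fun k => F (x k) - Fstar)].
Proof.
move=> F Fstar Xstar F_lb [xs Fxs] h hE E phi phi_sc lE lE_param lambda mu
  lambda0 lambdaL mu0 mulE lambda_ alpha_ lambda_E alpha_E x y yE xE.
have xs_min z : F xs <= F z.
  by rewrite Fxs; apply: ge_inf => //; exists z.
have f_ge y0 z := convex_gradient_le z f_convex (f_diff y0).
have f_le y0 z := lipschitz_gradient_le y0 z f_diff f_lip L_gt0.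
have hxs := hE xs Fxs.
have [_ lEc _] := lE_param.
have f_scE := modulus_convex_first_order f_convex f_diff lEc.
have [i0 i0E] : exists i, i \in E.
  have := strong_convexity_parameter_dim lE_param.
  by move=> /card_gt0P.
(* Along a basis vector indexed in [E], the strong convexity bound lies below the descent bound.
   Hence [mu * lambda <= 1] and [q <= 1]. *)
have lE_le : lE <= L.
  pose e : 'rV[R]_n := delta_mx 0 i0.
  have eE : supported_on E e.
    move=> i iE; rewrite mxE eqxx/=; case: eqVneq => // ii0.
    by rewrite ii0 i0E in iE.
  have s0 : supported_on E (0 : 'rV[R]_n) by move=> i _; rewrite mxE.
  have := le_trans (f_scE _ _ s0 eE) (f_le 0 e).
  rewrite lerD2l; have : 0 < dotp (e - 0) (e - 0).
    apply: lt_le_trans (sqr_coord_le _ i0).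
    by rewrite subr0 mxE !eqxx expr1n.
  move=> d0; rewrite ler_pM2r//; lra.
have mlt : lambda * L <= 1 by move: lambdaL; rewrite ler_pdivlMr.
set q := Num.sqrt (mu * lambda).
have ml0 : 0 < mu * lambda by rewrite mulr_gt0.
have q2 : q ^+ 2 = mu * lambda by rewrite sqr_sqrtr// ltW.
have q01 : 0 < q <= 1.
  rewrite sqrtr_gt0 ml0/= -sqrtr1 ler_wsqrtr//.
  have : mu * lambda <= L * lambda by rewrite ler_pM2r// (le_trans mulE).
  lra.
have f_sc u v : supported_on E u -> supported_on E v ->
    f u + dotp (gradient f u) (v - u) + mu / 2 * dotp (v - u) (v - u) <= f v.
  move=> uE vE; apply: le_trans (f_scE u v uE vE).
  rewrite lerD2l ler_wpM2r ?dotpp_ge0//; lra.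
have [delta delta0 delta_le] : exists2 delta, 0 < delta &
    forall i, i \notin E -> delta <= rho - `|gradient f xs 0 i|.
  apply: uniform_slack => i; rewrite inE hxs subr_gt0 lt_neqAle => ->/=.
  by rewrite -hxs; exact: (minimizer_gradient_le rho_gt0 f_le xs_min).
have gap0 z : 0 <= F z - F xs by rewrite subr_ge0.
pose alpha := (1 - q) / (1 + q).
have /andP[q0 q1] := q01.
have alpha0 : 0 <= alpha by rewrite divr_ge0 ?subr_ge0// addr_ge0// ltW.
have alpha1 : alpha < 1 by rewrite ltr_pdivrMr ?addr_gt0// mul1r; lra.
have yE' k : y k.+2 = x k.+1 + alpha *: (x k.+1 - x k) by rewrite yE// alpha_E.
have xE' k : x k.+2 = @prox_grad _ _ (gradient f) rho lambda (y k.+2).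
  by rewrite xE// lambda_E.
have suppx := eventually_supported L_gt0 rho_gt0 f_ge f_le f_lip lambda0 mlt
  xs_min delta0 mu0 delta_le f_sc alpha0 alpha1 yE' xE'.
have [C C0 gapC] := gap_geometric L_gt0 rho_gt0 f_ge f_le f_lip lambda0 mlt
  xs_min delta0 mu0 delta_le f_sc alpha0 alpha1 yE' xE' q01 q2 erefl.
have q10 : 0 <= 1 - q by rewrite subr_ge0.
have dC : \forall k \near \oo,
    dotp (x k - xs) (x k - xs) <= 2 / mu * C * (1 - q) ^+ k.
  near=> k.
  have gk : F (x k) - F xs <= C * (1 - q) ^+ k by near: k; exact: gapC.
  have sk : supported_on E (x k) by near: k; exact: suppx.
  have := gap_quadratic_growth rho_gt0 f_le xs_min delta0 delta_le f_sc sk.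
  move=> /le_trans/(_ gk) dk.
  by rewrite -mulrA -ler_pdivrMl ?divr_gt0// invf_div.
have r1 : linear_rate (1 - q) (fun k => F (x k) - Fstar).
  apply: (linear_rateP (C := C)); apply: filterS gapC => k.
  by rewrite -Fxs ger0_norm// (ger0_norm (exprn_ge0 k q10)).
have r2 : linear_rate (1 - q) (fun k => norm2 (x k - xs) ^+ 2).
  apply: (linear_rateP (C := 2 / mu * C)); apply: filterS dC => k.
  by rewrite norm2_sqr ger0_norm ?dotpp_ge0// (ger0_norm (exprn_ge0 k q10)).
exists xs; split => //.
- apply/seteqP; split => [z zmin|z ->] //=.
  (* At a zero gap the right side of this bound vanishes, so any minimizer [z] equals [xs]. *)
  have := gap_growth L_gt0 rho_gt0 f_ge f_le xs_min delta0 mu0 delta_le f_sc z.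
  have -> : f z + rho * norm1 z - (f xs + rho * norm1 xs) = 0.
    by apply/eqP; rewrite subr_eq0 eq_le; apply/andP; split;
      [exact: zmin | exact: xs_min].
  rewrite mul0r expr0n/= !mulr0 addr0 pmulr_rle0 ?divr_gt0// => zxs.
  by apply/eqP; rewrite -subr_eq0; apply/eqP/dotpp_le0.
(* The squared distance decays like [(1 - q) ^+ k], so the distance itself has the square root as
   its rate. *)
- exists (Num.sqrt (1 - q)); split.
    by rewrite sqrtr_ge0/= -[ltRHS]sqrtr1 ltr_sqrt// gtrBl.
  apply: (linear_rateP (C := Num.sqrt (2 / mu * C))); apply: filterS dC => k dk.
  have D0 : 0 <= 2 / mu * C by rewrite mulr_ge0// divr_ge0// ltW.
  rewrite !ger0_norm ?exprn_ge0 ?sqrtr_ge0//.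
  rewrite -ler_sqr ?nnegrE ?mulr_ge0 ?exprn_ge0 ?sqrtr_ge0//.
  by rewrite norm2_sqr exprMn exprAC !sqr_sqrtr.
- exists (1 - q); split; first by rewrite q10 gtrBl.
  apply: (linear_rateP (C := C)); apply: filterS gapC => k.
  by rewrite -Fxs normr_id ger0_norm// (ger0_norm (exprn_ge0 k q10)).
Unshelve. all: by end_near. Qed.
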